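(* Let $x\ge 3$ be a fixed integer, and let $G_{n,x}$ be the graph on $n$ vertices with domination number $x$ given by the construction described in the context. As $n\to\infty$, the number of dominating sets of size $x$ of $G_{n,x}$ is asymptotically equal to $$\left(\frac{\sqrt{2}}{x}\right)^{x} n^x \ \text{ when } x \text{ is even},\qquad \frac{2^{(x-1)/2}}{x^x}\,n^x \ \text{ when } x \text{ is odd}.$$
   Context: Graphs are finite and simple. A dominating set of a graph $G=(V,E)$ is a set $U\subseteq V$ such that each vertex in $V\setminus U$ is adjacent to some vertex of $U$; the domination number is the smallest cardinality of a dominating set. For an integer $r\ge 2$, the graph $\bigcirc_r$ on $r$ vertices is defined as follows. If $r$ is even, $\bigcirc_r$ is the complete multipartite graph $K_{2,2,\ldots,2}$ with $r/2$ parts of size $2$. If $r$ is odd, $\bigcirc_r$ is the complete multipartite graph $K_{3,2,\ldots,2}$ with $\lfloor r/2\rfloor$ parts, one of size $3$ and the others of size $2$, with one additional edge added inside the part of size $3$. It has domination number $2$. Construction of $G_{n,x}$: suppose first that $\frac{2}{x}n$ is an integer. If $x$ is even, $G_{n,x}$ is the disjoint union of $x/2$ copies of $\bigcirc_{2n/x}$. If $x$ is odd, $G_{n,x}$ is the disjoint union of $(x-1)/2$ copies of $\bigcirc_{2n/x}$ and one complete graph $K_{n/x}$. If $\frac{2}{x}n$ is not an integer, let $n'$ be the largest integer less than $n$ such that $\frac{2}{x}n'$ is an integer, use the component orders above with $n'$ in place of $n$, and then distribute the remaining $n-n'$ vertices as evenly as possible among the components of type $\bigcirc$ (that is, increase the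 orders of these components accordingly). *)

(* Defs.v *)
From mathcomp Require Import all_boot zify.

Set Implicit Arguments.
Unset Strict Implicit.
Unset Printing Implicit Defensive.

Local Open Scope nat_scope.

Record sgraph := SGraph {
  vertex :> finType;
  adj : rel vertex;
  adj_sym : symmetric adj;
  adj_irrefl : irreflexive adj
}.

Section Domination.
Variable G : sgraph.

Definition dominating (U : {set G}) : bool :=
  [forall v, (v \notin U) ==> [exists u in U, adj v u]].

Definition domination_number : nat :=
  #|[arg min_(U < [set: G] | dominating U) #|U| ]|.

Definition num_dominating_sets (k : nat) : nat :=
  #|[set U : {set G} | dominating U & #|U| == k]|.

End Domination.

Lemma complete_sym m : symmetric (fun i j : 'I_m => i != j).
Proof. by move=> i j; rewrite eq_sym. Qed.

Lemma complete_irrefl m : irreflexive (fun i j : 'I_m => i != j).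
Proof. by move=> i; rewrite eqxx. Qed.

Definition complete (m : nat) : sgraph :=
  SGraph (@complete_sym m) (@complete_irrefl m).

(* The index of the part of [bigcirc r] that contains the vertex i.  For r even
   the parts are {0,1}, {2,3}, ..., {r-2,r-1}; for r odd they are {0,1,2},
   {3,4}, ..., {r-2,r-1}. *)
Definition bigcirc_part (r i : nat) : nat := (i - odd r)./2.

(* The second disjunct is the additional edge, {0,1}, inside the part of size 3
   when r is odd. *)
Definition bigcirc_adj (r : nat) : rel 'I_r := fun i j =>
  (bigcirc_part r i != bigcirc_part r j) ||
  [&& odd r, i != j, i < 2 & j < 2].

Lemma bigcirc_sym r : symmetric (@bigcirc_adj r).
Proof.
move=> i j; rewrite /bigcirc_adj eq_sym (eq_sym i).
by rewrite (andbC (i < 2)).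
Qed.

Lemma bigcirc_irrefl r : irreflexive (@bigcirc_adj r).
Proof. by move=> i; rewrite /bigcirc_adj !eqxx /= andbF. Qed.

(* Only meaningful for r >= 2. *)
Definition bigcirc (r : nat) : sgraph :=
  SGraph (@bigcirc_sym r) (@bigcirc_irrefl r).

Section DisjointUnion.
Variables (I : finType) (G : I -> sgraph).

Definition dunion_adj : rel {i : I & G i} := fun u v =>
  (tag u == tag v) && adj (tagged u) (tagged_as u v).

Lemma dunion_sym : symmetric dunion_adj.
Proof.
move=> [i u] [j v]; rewrite /dunion_adj /= [j == i]eq_sym.
case: eqP => //= ij; case: j / ij v => v.
by rewrite !tagged_asE adj_sym.
Qed.

Lemma dunion_irrefl : irreflexive dunion_adj.
Proof. by move=> [i u]; rewrite /dunion_adj /= eqxx tagged_asE adj_irrefl. Qed.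

Definition disjoint_union : sgraph := SGraph dunion_sym dunion_irrefl.

End DisjointUnion.

(* The largest integer n' <= n such that (2 / x) n' is an integer; it is n
   itself exactly when (2 / x) n is an integer. *)
Definition base_order (n x : nat) : nat := \max_(m < n.+1 | x %| 2 * m) m.

(* The order of the i-th component of type bigcirc, 0 <= i < x./2: the
   n - n' remaining vertices are distributed evenly, the first components
   receiving the possible additional vertex. *)
Definition bigcirc_order (n x i : nat) : nat :=
  let n' := base_order n x in
  (2 * n') %/ x + (n - n') %/ x./2 + (i < (n - n') %% x./2).

Definition component (n x i : nat) : sgraph :=
  if i < x./2 then bigcirc (bigcirc_order n x i)
  else complete (base_order n x %/ x).

(* There are uphalf x components: if x is even, x / 2 of type bigcirc; if x is
   odd, (x - 1) / 2 of type bigcirc, and a complete graph as the last one.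
   For n < x the construction has degenerate components. *)
Definition Gnx (n x : nat) : sgraph :=
  disjoint_union (fun i : 'I_(uphalf x) => component n x i).

Lemma domination_numberP (G : sgraph) (k : nat) :
  (exists2 U : {set G}, dominating U & #|U| = k) ->
  (forall U : {set G}, dominating U -> k <= #|U|) ->
  domination_number G = k.
Proof.
move=> [U domU cU] lb; rewrite /domination_number.
case: arg_minnP => [|V domV minV].
  by apply/forallP => v; rewrite inE.
by apply/eqP; rewrite eqn_leq lb // andbT -cU minV.
Qed.

Lemma domination_number_le (G : sgraph) (U : {set G}) :
  dominating U -> domination_number G <= #|U|.
Proof.
move=> domU; rewrite /domination_number.
by case: arg_minnP => [|V _]; [apply/forallP => v; rewrite inE | apply].
Qed.

Lemma domination_number_ex (G : sgraph) :
  exists2 U : {set G}, dominating U & #|U| = domination_number G.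
Proof.
rewrite /domination_number; case: arg_minnP => [|U domU _].
  by apply/forallP => v; rewrite inE.
by exists U.
Qed.

Lemma domination_number_complete m :
  0 < m -> domination_number (complete m) = 1.
Proof.
case: m => // m _; apply: domination_numberP => [|U /forallP domU].
  exists [set ord0 : complete m.+1]; last by rewrite cards1.
  apply/forallP => v; apply/implyP => vU; apply/existsP; exists ord0.
  by rewrite inE eqxx /=; move: vU; rewrite inE.
rewrite card_gt0; apply/negP => /eqP U0; have := domU ord0.
by rewrite U0 inE /= => /existsP[u]; rewrite inE.
Qed.

Lemma domination_number_bigcirc r :
  1 < r -> domination_number (bigcirc r) = 2.
Proof.
move=> r1; have r0 : 0 < r by lia.
apply: domination_numberP => [|U /forallP domU].
  (* the vertices 0 and r-1 *)
  have lr : r.-1 < r by lia.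
  exists [set (Ordinal r0 : bigcirc r); Ordinal lr]; last first.
    by rewrite cards2 -val_eqE /=; case: eqP => //; lia.
  apply/forallP => v; apply/implyP; rewrite !inE -!val_eqE /= => /norP[v0 vl].
  case: (boolP (adj v (Ordinal r0 : bigcirc r))) => [a|].
    by apply/existsP; exists (Ordinal r0); rewrite !inE eqxx.
  rewrite /= /bigcirc_adj negb_or negbK -val_eqE /= => /andP[/eqP e b].
  apply/existsP; exists (Ordinal lr); rewrite !inE eqxx orbT /= /bigcirc_adj /=.
  apply/orP; left; rewrite e /bigcirc_part.
  have := ltn_ord v; move: v0 vl e b; rewrite /bigcirc_part.
  case: (boolP (odd r)) => /= o; lia.
rewrite ltnNge; apply/negP => /card_le1P U1.
have [u uU] : exists u, u \in U.
  case: (boolP (Ordinal r0 \in U)) => [|n0]; first by exists (Ordinal r0).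
  have := domU (Ordinal r0); rewrite n0 /= => /existsP[u /andP[uU _]].
  by exists u.
(* a vertex w that is not adjacent to u *)
have [w nw nadj] : exists2 w : bigcirc r, w != u & ~~ adj w u.
  have := ltn_ord u; case: u uU => u lu uU /= _.
  pose w := if odd r then (if u < 2 then 2 else if u == 2 then 0
                           else if odd u then u.+1 else u.-1)
            else (if odd u then u.-1 else u.+1).
  have lw : w < r by rewrite /w; case: (boolP (odd r)); do !case: ifP; lia.
  exists (Ordinal lw); first by rewrite -val_eqE /= /w; do !case: ifP; lia.
  rewrite /= /bigcirc_adj /bigcirc_part -val_eqE /= /w.
  by case: (boolP (odd r)) => /= o; do !case: ifP; lia.
have wU : w \notin U by rewrite (U1 _ uU) inE.
have := domU w; rewrite wU => /existsP[v /andP[vU av]].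
by move: vU; rewrite (U1 _ uU) inE => /eqP vu; rewrite vu (negbTE nadj) in av.
Qed.

Section DisjointUnionDomination.
Variables (I : finType) (G : I -> sgraph).

Definition slice (U : {set disjoint_union G}) (i : I) : {set G i} :=
  [set v | Tagged (fun i => vertex (G i)) v \in U].

Lemma card_slice (U : {set disjoint_union G}) :
  #|U| = \sum_i #|slice U i|.
Proof.
rewrite -sum1_card.
under [RHS]eq_bigr => i _ do rewrite -sum1_card.
rewrite (sig_big_dep _ (fun i v => v \in slice U i)) /=.
by apply: eq_bigl => -[i v]; rewrite inE.
Qed.

Lemma dominating_slice (U : {set disjoint_union G}) :
  dominating U = [forall i, dominating (slice U i)].
Proof.
apply/forallP/forallP => [h i|h [i v]].
  apply/forallP => v; apply/implyP; rewrite inE => vU.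
  have := h (Tagged (fun i => vertex (G i)) v).
  rewrite vU => /existsP[[j u] /andP[uU]]; rewrite /= /dunion_adj /=.
  case/andP => /eqP ij; case: j / ij u uU => u uU; rewrite tagged_asE => a.
  by apply/existsP; exists u; rewrite inE uU.
apply/implyP => vU; have /forallP/(_ v) := h i; rewrite inE vU.
move=> /existsP[u /andP[]]; rewrite inE => uU a.
apply/existsP; exists (Tagged (fun i => vertex (G i)) u).
by rewrite uU /= /dunion_adj /= eqxx tagged_asE.
Qed.

Lemma card_disjoint_union : #|disjoint_union G| = \sum_i #|G i|.
Proof.
rewrite -cardsT card_slice; apply: eq_bigr => i _; rewrite -cardsT.
by congr #|pred_of_set _|; apply/setP => v; rewrite !inE.
Qed.

Lemma domination_number_disjoint_union :
  domination_number (disjoint_union G) = \sum_i domination_number (G i).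
Proof.
apply: domination_numberP => [|U]; last first.
  rewrite dominating_slice card_slice => /forallP h.
  by apply: leq_sum => i _; exact: domination_number_le.
have ex i : [exists V : {set G i},
    dominating V && (#|V| == domination_number (G i))].
  have [V h1 h2] := domination_number_ex (G i).
  by apply/existsP; exists V; rewrite h1 h2 eqxx.
pose V i := xchoose (existsP (ex i)).
have /all_and2[V1 V2] i : dominating (V i) /\ #|V i| = domination_number (G i).
  by have /andP[? /eqP ?] := xchooseP (existsP (ex i)).
pose U : {set disjoint_union G} := [set u | tagged u \in V (tag u)].
have sU i : slice U i = V i by apply/setP => v; rewrite !inE.
exists U; first by rewrite dominating_slice; apply/forallP => i; rewrite sU.
by rewrite card_slice; apply: eq_bigr => i _; rewrite sU.
Qed.

End DisjointUnionDomination.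

Lemma base_orderP n x : base_order n x <= n /\ x %| 2 * base_order n x.
Proof.
have P0 : x %| 2 * (ord0 : 'I_n.+1) by rewrite muln0 dvdn0.
rewrite /base_order (bigmax_eq_arg _ P0).
by case: arg_maxnP => //= i di _; split; rewrite // -ltnS.
Qed.

Lemma base_order_max n x m : m <= n -> x %| 2 * m -> m <= base_order n x.
Proof.
move=> mn dm; rewrite -[m]/(nat_of_ord (Ordinal (mn : m < n.+1))).
exact: leq_bigmax_cond.
Qed.

Lemma base_order_id n x : x %| 2 * n -> base_order n x = n.
Proof.
move=> h; apply/eqP; rewrite eqn_leq base_order_max // andbT.
by have [] := base_orderP n x.
Qed.

Lemma sum_ltn k m : m <= k -> \sum_(i < k) (i < m : nat) = m.
Proof.
move=> mk; rewrite -(big_mkord xpredT (fun i => (i < m : nat))).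
rewrite (big_cat_nat (n := m)) //= big_nat.
under eq_bigr => i /andP[_ ->] do [].
rewrite -big_nat sum_nat_const_nat big_nat big1 ?subn0; first by lia.
by move=> i /andP[]; rewrite leqNgt => /negbTE ->.
Qed.

(* [Gnx n x] has n vertices ... *)
Lemma card_Gnx n x : 1 < x -> #|Gnx n x| = n.
Proof.
move=> x1; rewrite card_disjoint_union.
have [n'n dn'] := base_orderP n x.
set n' := base_order n x in n'n dn' *; set k := x./2.
have k0 : 0 < k by rewrite /k; lia.
have card_c i : #|component n x i| =
    if i < k then bigcirc_order n x i else n' %/ x.
  by rewrite /component -/k; case: ifP => _ /=; rewrite card_ord.
under eq_bigr => i _ do rewrite card_c.
have circs : \sum_(i < k) bigcirc_order n x i = k * (2 * n' %/ x) + (n - n').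
  rewrite /bigcirc_order -/n' -/k !big_split /= !sum_nat_const card_ord.
  rewrite sum_ltn ?(ltnW (ltn_pmod _ _)) // -addnA; congr (_ + _).
  by rewrite [RHS](divn_eq _ k) mulnC.
have ex : x = odd x + k.*2 by rewrite odd_double_half.
rewrite uphalf_half -/k.
have [q eq] := dvdnP dn'; have x0 : 0 < x by lia.
rewrite eq mulnK // in circs.
move: ex; case: (boolP (odd x)) => o; rewrite ?add0n ?add1n => ex.
  rewrite big_ord_recr /= ltnn.
  under eq_bigr => i _ do rewrite ltn_ord.
  rewrite circs; have /dvdnP[p ep] : x %| n'.
    by rewrite -(@Gauss_dvdr x 2) // coprimen2.
  have -> : n' %/ x = p by rewrite ep mulnK.
  have : q = 2 * p by nia.
  nia.
under eq_bigr => i _ do rewrite ltn_ord.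
rewrite circs; nia.
Qed.

(* ... and domination number x. *)
Lemma domination_number_Gnx n x :
  1 < x -> x <= n -> domination_number (Gnx n x) = x.
Proof.
move=> x1 xn; rewrite domination_number_disjoint_union.
have x0 : 0 < x by lia.
have n'x : x <= base_order n x by apply: base_order_max; rewrite ?dvdn_mull.
have dom_c i : domination_number (component n x i) = if i < x./2 then 2 else 1.
  rewrite /component; case: ifP => _.
    apply: domination_number_bigcirc; rewrite /bigcirc_order.
    apply: leq_trans (_ : 2 * base_order n x %/ x <= _).
      by rewrite leq_divRL // leq_mul2l n'x.
    by rewrite -addnA leq_addr.
  by apply: domination_number_complete; rewrite divn_gt0.
under eq_bigr => i _ do rewrite dom_c.
rewrite uphalf_half; have := odd_double_half x.
case: (odd x); rewrite ?add0n ?add1n => ex.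
  rewrite big_ord_recr /= ltnn.
  under eq_bigr => i _ do rewrite ltn_ord.
  rewrite sum_nat_const card_ord; lia.
under eq_bigr => i _ do rewrite ltn_ord.
rewrite sum_nat_const card_ord; lia.
Qed.

(* Main.v *)
Require Import Defs.
From mathcomp Require Import all_boot all_order all_algebra.
From mathcomp Require Import all_classical all_reals all_analysis.
From mathcomp Require Import zify ring lra.
Import Order.TTheory GRing.Theory Num.Theory numFieldNormedType.Exports.

(* The domination number x of G_{n,x} is the sum of the domination numbers of
   its components, so a dominating set of size x meets each component in a
   minimum dominating set, and the count is a product over the components.  The
   complete graph K_m contributes m.  In bigcirc_r every pair of vertices
   dominates, except the additional edge when r is odd, so it contributes
   'C(r, 2) or 'C(r, 2) - 1.  With r ~ 2n/x and m ~ n/x, the factors are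
   asymptotic to 2 n^2 / x^2 and n / x. *)

Set Implicit Arguments.
Unset Strict Implicit.
Unset Printing Implicit Defensive.

Local Open Scope nat_scope.

(** * Minimum dominating sets of disjoint unions and of the components *)

(** A set is determined by its slices, and any choice of minimum dominating sets in the components
    glues to a minimum one. *)
Lemma num_dominating_sets_disjoint_union (I : finType) (G : I -> sgraph) :
  num_dominating_sets (disjoint_union G) (\sum_i domination_number (G i)) =
  \prod_i num_dominating_sets (G i) (domination_number (G i)).
Proof.
pose D i :=
    [set V : {set G i} | dominating V & #|V| == domination_number (G i)].
pose f (U : {set disjoint_union G}) : {dffun forall i, {set G i}} :=
  [ffun i => slice U i].
have f_inj : injective f.
  move=> U V /ffunP fUV; apply/setP => -[i v].
  by have /setP/(_ v) := fUV i; rewrite !ffunE !inE.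
rewrite /num_dominating_sets -(card_imset _ f_inj).
transitivity #|(family D : simpl_pred {dffun forall i, {set G i}})|; last first.
  by rewrite card_family foldrE big_image.
apply: eq_card => g; apply/imsetP/familyP => [[U + ->] i|gD].
  rewrite inE card_slice dominating_slice eq_sym => /andP[/forallP domU].
  (* No slice is smaller than its domination number, so equality of the sums forces equality in
     every component. *)
  have [_ ->] := leqif_sum
    (fun i (_ : true) => leqif_eq (domination_number_le (domU i))).
  by rewrite ffunE inE domU [#|_| == _]eq_sym  => /forallP/(_ i).
pose U : {set disjoint_union G} := [set u | tagged u \in g (tag u)].
have sU i : slice U i = g i by apply/setP => v; rewrite !inE.
exists U; last by apply/ffunP => i; rewrite ffunE sU.
rewrite inE dominating_slice card_slice; apply/andP; split.
  by apply/forallP => i; rewrite sU; have := gD i; rewrite inE => /andP[].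
apply/eqP/eq_bigr => i _; rewrite sU.
by have := gD i; rewrite inE => /andP[_ /eqP].
Qed.

Lemma num_dominating_sets_complete m : num_dominating_sets (complete m) 1 = m.
Proof.
rewrite -[RHS]bin1 -[m in RHS]card_ord -card_draws; apply: eq_card => U.
rewrite !inE andb_idl // => /cards1P[u ->]; apply/forallP => v.
by apply/implyP => vU; apply/existsP; exists u; move: vU; rewrite !inE eqxx.
Qed.

(* For r odd, the only pair that does not dominate is the additional edge {0,1},
   which misses the third vertex of its part. *)
Lemma num_dominating_sets_bigcirc r :
  1 < r -> num_dominating_sets (bigcirc r) 2 = 'C(r, 2) - odd r.
Proof.
move=> r1; have r0 : 0 < r by lia.
pose o0 : bigcirc r := Ordinal r0; pose o1 : bigcirc r := Ordinal r1.
have domE (U : {set bigcirc r}) :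
    #|U| = 2 -> dominating U = ~~ (odd r && (U == [set o0; o1])).
  move=> /eqP/cards2P[u [v [uv ->{U}]]]; apply/idP/idP.
    move=> /forallP domU; apply/andP => -[ro /eqP e].
    have r2 : 2 < r by case: r ro r1 {r0 o0 o1 u v uv domU e} => [|[|[|]]].
    have := domU (Ordinal r2); rewrite e !inE -!val_eqE => /existsP[w /andP[]].
    rewrite !inE -!val_eqE /= /bigcirc_adj /bigcirc_part ro /=.
    by move=> /orP[] /eqP ->; rewrite andbF.
  move=> h; apply/forallP => w; apply/implyP; rewrite !inE => /norP[wu wv].
  apply/existsP.
  suff /orP[a|a] : adj w u || adj w v.
  - by exists u; rewrite !inE eqxx.
  - by exists v; rewrite !inE eqxx orbT.
  (* If [w] is adjacent to neither [u] nor [v], the three distinct vertices fill the part {0,1,2},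
     so [r] is odd. Since 0 and 1 are adjacent, [w] is 2 and the pair is {0,1}. *)
  apply: contraR h; rewrite finset.eqEsubset !finset.subUset !finset.sub1set !inE.
  move: uv wu wv; rewrite /= /bigcirc_adj /bigcirc_part -!val_eqE /=.
  have := ltn_ord u; have := ltn_ord v; have := ltn_ord w.
  move: (u : nat) (v : nat) (w : nat) => a b c.
  by case: (boolP (odd r)) => /= o; lia.
have -> : num_dominating_sets (bigcirc r) 2 =
    #|[set U : {set bigcirc r} | #|U| == 2] :\:
      [set U | odd r & U == [set o0; o1]]|.
  apply: eq_card => U; rewrite !inE andbC [RHS]andbC.
  by case: eqP => //= U2; rewrite domE.
rewrite cardsD card_draws card_ord; congr (_ - _).
rewrite (_ : _ :&: _ = if odd r then [set [set o0; o1]] else finset.set0); last first.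
  apply/setP => U; rewrite !inE; case: ifP; rewrite !inE ?andbF //= => _.
  by rewrite andb_idl // => /eqP ->; rewrite cards2.
by case: (odd r); rewrite ?cards1 ?cards0.
Qed.

(** * Orders of the components and the product formula *)

Lemma leq_base_orderD n x : 0 < x -> n <= base_order n x + x.
Proof.
move=> x0; have : n - n %% x <= base_order n x.
  apply: base_order_max; first exact: leq_subr.
  by rewrite dvdn_mull // {1}(divn_eq n x) addnK dvdn_mull.
by have := ltn_pmod n x0; lia.
Qed.

(** The order is 2n/x up to an error bounded independently of n: n' is within x of n, and each
    component receives at most x + 1 extra vertices. *)
Lemma bigcirc_order_bounds n x i : 1 < x ->
  (x * bigcirc_order n x i <= 2 * n + x * x.+1) /\
  (2 * n <= x * bigcirc_order n x i + x * x.+1).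
Proof.
move=> x1; have [n'n dn'] := base_orderP n x.
have n'x : n <= base_order n x + x by apply: leq_base_orderD; lia.
rewrite /bigcirc_order; set n' := base_order n x in n'n dn' n'x *.
have e : 2 * n' = (2 * n') %/ x * x by rewrite divnK.
have q : (n - n') %/ x./2 <= x by apply: leq_trans (leq_div _ _) _; lia.
set d := (n - n') %/ x./2 in q *; set b := (i < _).
have b1 : b <= 1 by case: b.
by set c := (2 * n') %/ x in e *; nia.
Qed.

Lemma domination_number_component n x i : 1 < x -> x <= n ->
  domination_number (component n x i) = if i < x./2 then 2 else 1.
Proof.
move=> x1 xn; have n'x : x <= base_order n x.
  by apply: base_order_max; rewrite ?dvdn_mull.
rewrite /component; case: ifP => _.
  apply: domination_number_bigcirc.
  rewrite /bigcirc_order -addnA (leq_trans _ (leq_addr _ _)) //.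
  by rewrite leq_divRL ?leq_mul2l ?n'x //; lia.
by apply: domination_number_complete; rewrite divn_gt0 //; lia.
Qed.

Definition component_count (n x i : nat) : nat :=
  if i < x./2 then
    'C(bigcirc_order n x i, 2) - odd (bigcirc_order n x i)
  else base_order n x %/ x.

(** Stated for any commutative monoid, as it serves both the sum of the domination numbers and the
    product of the limits. *)
Lemma big_if_half (T : Type) (idx : T) (op : Monoid.com_law idx) x (a b : T) :
  \big[op/idx]_(i < uphalf x) (if i < x./2 then a else b) =
  op (\big[op/idx]_(i < x./2) a) (\big[op/idx]_(i < odd x) b).
Proof.
rewrite uphalf_half addnC big_split_ord /=; congr (op _ _).
  by apply: eq_bigr => i _; rewrite ltn_ord.
by apply: eq_bigr => i _; rewrite ltnNge leq_addr.
Qed.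

Lemma sum_component_domination x :
  \sum_(i < uphalf x) (if i < x./2 then 2 else 1) = x.
Proof.
rewrite big_if_half /= !sum_nat_const !card_ord.
by have := odd_double_half x; lia.
Qed.

Lemma num_dominating_sets_Gnx n x : 1 < x -> x <= n ->
  num_dominating_sets (Gnx n x) x = \prod_(i < uphalf x) component_count n x i.
Proof.
move=> x1 xn; have domE i := domination_number_component i x1 xn.
rewrite -{2}(sum_component_domination x).
under eq_bigr => i _ do rewrite -(domE i).
rewrite num_dominating_sets_disjoint_union; apply: eq_bigr => i _.
have := domE i; rewrite /component_count /component.
case: ifP => ix D; rewrite D.
  apply: num_dominating_sets_bigcirc.
  (* The order is at least 2 because some dominating set has two vertices. *)
  rewrite ltnNge; apply/negP => r1.
  have [U _ U2] := domination_number_ex (bigcirc (bigcirc_order n x i)).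
  have := max_card (mem U); rewrite U2 D card_ord; lia.
exact: num_dominating_sets_complete.
Qed.

Local Open Scope ring_scope.
Local Open Scope classical_set_scope.

(** * Limits of quotients and asymptotic equivalence *)

Section Limits.
Variable R : realType.

Lemma cvg_natV : (n%:R^-1 : R) @[n --> \oo] --> (0 : R).
Proof.
apply/(gtr0_cvgV0 (f := fun n => n%:R : R)); last exact: cvgr_idn.
by near=> n; rewrite ltr0n; near: n; exact: nbhs_infty_gt.
Unshelve. all: by end_near. Qed.

Lemma cvg_div_nat (u : nat -> nat) (a b c : nat) : (0 < b)%N ->
  (forall n, (b * u n <= a * n + c)%N /\ (a * n <= b * u n + c)%N) ->
  ((u n)%:R / n%:R : R) @[n --> \oo] --> (a%:R / b%:R : R).
Proof.
move=> b0 ub; have b0' : 0 < b%:R :> R by rewrite ltr0n.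
apply: (@squeeze_cvgr _ _ _ _ (fun n => a%:R / b%:R - c%:R / b%:R * n%:R^-1)
  (fun n => a%:R / b%:R + c%:R / b%:R * n%:R^-1)).
- near=> n.
  have n0 : 0 < n%:R :> R by rewrite ltr0n; near: n; exact: nbhs_infty_gt.
  have [] := ub n; rewrite -!(ler_nat R) !natrD !natrM => h1 h2.
  have E v : (v%:R / n%:R : R) = (b%:R * v%:R) / (b%:R * n%:R).
    by field; rewrite ?gt_eqF.
  have -> : a%:R / b%:R - c%:R / b%:R * n%:R^-1 =
      (a%:R * n%:R - c%:R) / (b%:R * n%:R) :> R by field; rewrite ?gt_eqF.
  have -> : a%:R / b%:R + c%:R / b%:R * n%:R^-1 =
      (a%:R * n%:R + c%:R) / (b%:R * n%:R) :> R by field; rewrite ?gt_eqF.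
  have bn0 : 0 < (b%:R * n%:R)^-1 :> R by rewrite invr_gt0 mulr_gt0.
  by rewrite E !ler_pM2r //; lra.
- rewrite -[X in _ --> X]subr0 -[X in _ - X](mulr0 (c%:R / b%:R)).
  apply: cvgB; first exact: cvg_cst.
  by apply: cvgM; [exact: cvg_cst|exact: cvg_natV].
- rewrite -[X in _ --> X]addr0 -[X in _ + X](mulr0 (c%:R / b%:R)).
  apply: cvgD; first exact: cvg_cst.
  by apply: cvgM; [exact: cvg_cst|exact: cvg_natV].
Unshelve. all: by end_near. Qed.

(** With r = r(n), the numerator lies between (r^2 - r - 2)/2 and r^2/2; after division by n^2 the
    lower-order terms vanish. *)
Lemma cvg_bin2_div (r : nat -> nat) (a : R) :
  ((r n)%:R / n%:R : R) @[n --> \oo] --> a ->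
  (('C(r n, 2) - odd (r n))%:R / n%:R ^+ 2 : R) @[n --> \oo] --> a ^+ 2 / 2.
Proof.
move=> ra.
apply: (@squeeze_cvgr _ _ _ _
  (fun n => ((r n)%:R / n%:R * ((r n)%:R / n%:R) - (r n)%:R / n%:R * n%:R^-1
              - 2 * (n%:R^-1 * n%:R^-1)) / 2)
  (fun n => (r n)%:R / n%:R * ((r n)%:R / n%:R) / 2)).
- near=> n.
  have n0 : 0 < n%:R :> R by rewrite ltr0n; near: n; exact: nbhs_infty_gt.
  (* Valid also for r n = 1, where the subtraction is truncated. *)
  have [h1 h2] : ((r n) * (r n) <= 2 * ('C(r n, 2) - odd (r n)) + r n + 2)%N /\
      (2 * ('C(r n, 2) - odd (r n)) <= r n * r n)%N.
    rewrite bin2; case: (r n) => [|m] //=.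
    (* The product m(m+1) is even, so the halving in [bin2] is exact. *)
    have := odd_double_half (m.+1 * m); rewrite oddM /= andNb add0n.
    by case: (odd m) => /=; nia.
  move: h1 h2; rewrite -!(ler_nat R) !natrD !natrM.
  set c := (_ - _)%:R; set s := (r n)%:R => h1 h2.
  have -> : (s / n%:R * (s / n%:R) - s / n%:R * n%:R^-1
              - 2 * (n%:R^-1 * n%:R^-1)) / 2 =
      (s * s - s - 2) / 2 / n%:R ^+ 2 by field; rewrite gt_eqF.
  have -> : s / n%:R * (s / n%:R) / 2 = s * s / 2 / n%:R ^+ 2.
    by field; rewrite gt_eqF.
  by rewrite !ler_pM2r ?invr_gt0 ?exprn_gt0 //; lra.
- rewrite (_ : a ^+ 2 / 2 = (a * a - a * 0 - 2 * (0 * 0)) / 2); last first.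
    by rewrite !mulr0 !subr0 expr2.
  apply: cvgM; last exact: cvg_cst.
  apply: cvgB.
    by apply: cvgB; apply: cvgM => //; exact: cvg_natV.
  by apply: cvgM; first exact: cvg_cst; apply: cvgM; exact: cvg_natV.
- by rewrite expr2; apply: cvgM; [exact: cvgM|exact: cvg_cst].
Unshelve. all: by end_near. Qed.

Lemma equiv_of_cvg_div (f h : nat -> R) (c : R) : c != 0 ->
  (\forall n \near \oo, h n != 0) ->
  f n / h n @[n --> \oo] --> c -> f ~_\oo (fun n => c * h n).
Proof.
move=> c0 h0 /cvgrPdist_le fh; apply/eqaddoP => e e0.
(* The error is measured against [c * h n], hence the tolerance scaled by the norm of [c]. *)
have ec0 : 0 < e * `|c| by rewrite mulr_gt0 ?normr_gt0.
near=> n; have hn0 : h n != 0 by near: n.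
have -> : (f - (fun n => c * h n)) n = - ((c - f n / h n) * h n).
  by rewrite mulrBl divfK // opprB.
rewrite normrN !normrM mulrA ler_wpM2r //.
by near: n; exact: fh.
Unshelve. all: by end_near. Qed.

End Limits.

(** * Asymptotics of the count for [Gnx] *)

Lemma cvg_component_count (R : realType) (x i : nat) : (1 < x)%N ->
  ((component_count n x i)%:R / n%:R ^+ (if (i < x./2)%N then 2 else 1) : R)
    @[n --> \oo] -->
  (if (i < x./2)%N then (2 / x%:R) ^+ 2 / 2 else x%:R^-1 : R).
Proof.
move=> x1; rewrite /component_count; case: ifP => _.
  apply: cvg_bin2_div; apply: (cvg_div_nat (c := x * x.+1)); first by lia.
  by move=> n; have := bigcirc_order_bounds n i x1; lia.
rewrite -[X in _ --> X]div1r.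
(* The error 2x allows x for replacing n by n' and x for rounding the quotient. *)
apply: (cvg_div_nat (a := 1) (c := 2 * x)) => [|n]; first by lia.
have [n'n _] := base_orderP n x; have := @leq_base_orderD n x ltac:(lia).
have := divn_eq (base_order n x) x.
have := @ltn_pmod (base_order n x) x ltac:(lia).
by lia.
Qed.

Lemma equiv_num_dominating_sets_Gnx (R : realType) (x : nat) : (1 < x)%N ->
  (fun n => (num_dominating_sets (Gnx n x) x)%:R : R) ~_\oo
  (fun n => (2 / x%:R ^+ 2) ^+ x./2 * x%:R^-1 ^+ odd x * n%:R ^+ x : R).
Proof.
move=> x1; have x0 : x%:R != 0 :> R by rewrite pnatr_eq0; lia.
apply: equiv_of_cvg_div.
- rewrite mulf_neq0 // expf_neq0 ?invr_neq0 //.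
  by rewrite mulf_neq0 ?invr_neq0 ?expf_neq0 // pnatr_eq0.
- near=> n; rewrite expf_neq0 // pnatr_eq0 -lt0n; near: n; exact: nbhs_infty_gt.
have -> : (2 / x%:R ^+ 2) ^+ x./2 * x%:R^-1 ^+ odd x =
    \prod_(i < uphalf x)
      (if (i < x./2)%N then (2 / x%:R) ^+ 2 / 2 else x%:R^-1) :> R.
  rewrite big_if_half /= !prodr_const !card_ord; congr (_ ^+ _ * _).
  by field.
(* The normalized counts converge factor by factor. Their exponents 2 and 1 are the domination
   numbers, which sum to x, so the denominators multiply to n^x. *)
have := cvg_big (@mul_continuous R) (r := index_enum 'I_(uphalf x))
  (P := xpredT) (F := \oo) _ (fun i _ => @cvg_component_count R x i x1).
move=> /(_ 1 _); apply: cvg_trans; apply: near_eq_cvg; near=> n.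
rewrite num_dominating_sets_Gnx //; last by near: n; exact: nbhs_infty_ge.
by rewrite prodf_div prodrXr sum_component_domination natr_prod.
Unshelve. all: by end_near. Qed.

Theorem mainTheorem4 (R : realType) (x : nat) (hx : (3 <= x)%N) :
  (~~ odd x ->
     (fun n : nat => (num_dominating_sets (Gnx n x) x)%:R : R) ~_\oo
     (fun n : nat => (Num.sqrt 2 / x%:R) ^+ x * n%:R ^+ x : R)) /\
  (odd x ->
     (fun n : nat => (num_dominating_sets (Gnx n x) x)%:R : R) ~_\oo
     (fun n : nat => 2 ^+ ((x - 1) %/ 2) / x%:R ^+ x * n%:R ^+ x : R)).
Proof.
have := @equiv_num_dominating_sets_Gnx R x ltac:(lia).
have := odd_double_half x; rewrite -mul2n.
case: (odd x) => /= xE eqv; split=> // _.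
- have -> : ((x - 1) %/ 2)%N = x./2 by lia.
  suff -> : 2 ^+ x./2 / x%:R ^+ x =
      (2 / x%:R ^+ 2) ^+ x./2 * x%:R^-1 ^+ 1 :> R by [].
  rewrite -{3}xE exprD exprM expr_div_n invfM !expr1 -mulrA; congr (_ * _).
  by rewrite mulrC.
- suff -> : (Num.sqrt 2 / x%:R) ^+ x =
      (2 / x%:R ^+ 2) ^+ x./2 * x%:R^-1 ^+ 0 :> R by [].
  (* Writing x = 2k turns the power of sqrt 2 / x into the k-th power of its square 2 / x^2. *)
  by rewrite -{2}xE exprM expr_div_n sqr_sqrtr // expr0 mulr1.
Qed.
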